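(* Let $F$ be a field and let $A$ be a monomial $\mathbb P^1$ over $F$, i.e. a prime monomial algebra with Hilbert series $\frac1{(1-t)^2}$. If $B$ is a prime monomial $F$-algebra which is isomorphic to a (Zhang) twist of $A$, then $A\cong B$.
   Context: A monomial algebra is a quotient of a finitely generated free associative algebra $F\langle x_1,\dots,x_m\rangle$ by an ideal generated by monomials, graded by $\deg x_i=1$; its Hilbert series is $\sum_n(\dim_FA_n)t^n$. A twisting system of a connected graded algebra $A=\bigoplus_{n\ge 0}A_n$ is a sequence $\tau=\{\tau_n\}_{n\ge0}$ of degree-preserving linear automorphisms of $A$ with $\tau_n(x\,\tau_m(y))=\tau_n(x)\,\tau_{n+m}(y)$ for all $n,m\ge0$, all $x\in A_m$ and all homogeneous $y\in A$. The twist $A^\tau$ is the graded algebra with the same underlying graded vector space as $A$ and multiplication $x\star y=x\,\tau_n(y)$ for $x\in A_n$ and $y$ homogeneous, extended linearly. *)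

(* Defs.v *)
From HB Require Import structures.
From mathcomp Require Import all_boot all_order all_algebra.
From mathcomp Require Import finmap boolp.
From mathcomp Require Import monalg.

Set Implicit Arguments.
Unset Strict Implicit.
Unset Printing Implicit Defensive.

Import GRing.Theory.
Local Open Scope ring_scope.

(* Unital associative F-algebras with an internal direct sum decomposition
   indexed by nat.  Decompositions x_0 + x_1 + ... are finite sequences, so
   [s`_i] is 0 for i beyond the length of s. *)
Record gradedAlgebra (F : fieldType) := GradedAlgebra {
  gcarrier :> algType F;
  component : nat -> gcarrier -> Prop;
  component0 : forall n, component n 0;
  componentP : forall n (a : F) x y,
    component n x -> component n y -> component n (a *: x + y);
  component1 : component 0 1;
  componentM : forall n m x y,
    component n x -> component m y -> component (n + m) (x * y);
  component_dec : forall x, exists s : seq gcarrier,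
    (forall i, component i s`_i) /\ x = \sum_(i < size s) s`_i;
  component_direct : forall s : seq gcarrier,
    (forall i, component i s`_i) -> \sum_(i < size s) s`_i = 0 ->
    forall i, s`_i = 0
}.

Definition homogeneous (F : fieldType) (A : gradedAlgebra F) (x : A) :=
  exists n, component n x.

Definition graded_iso (F : fieldType) (A B : gradedAlgebra F) :=
  exists f : {lrmorphism A -> B},
    bijective f /\ (forall n x, component n x -> component n (f x)).

Section GradedTheory.
Variables (F : fieldType) (A : gradedAlgebra F).
Implicit Types (x y : A) (s : seq A).

Lemma componentD n x y : component n x -> component n y -> component n (x + y).
Proof. by move=> hx hy; rewrite -[x]scale1r; apply: componentP. Qed.

Lemma componentZ n a x : component n x -> component n (a *: x).
Proof.
by move=> hx; rewrite -[_ *: _]addr0; apply: componentP=> //; apply: component0.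
Qed.

Definition gdec x : seq A := projT1 (cid (component_dec x)).
Definition gproj n x : A := (gdec x)`_n.

Lemma gprojP n x : component n (gproj n x).
Proof. by rewrite /gproj /gdec; case: cid => s [] /=. Qed.

Lemma sum_gproj x : x = \sum_(i < size (gdec x)) gproj i x.
Proof. by rewrite /gproj /gdec; case: cid => s []. Qed.

Lemma sum_nth_widen (h : nat -> A -> A) s N : (forall i, h i 0 = 0) ->
  (size s <= N)%N -> \sum_(i < N) h i s`_i = \sum_(i < size s) h i s`_i.
Proof.
move=> h0 le; rewrite (big_ord_widen _ (fun i => h i s`_i) le) [RHS]big_mkcond.
by apply: eq_bigr => i _; case: ltnP => // /(nth_default 0) ->; rewrite h0.
Qed.

Lemma gproj_unique x N (c : nat -> A) :
  (forall i, (i < N)%N -> component i (c i)) -> x = \sum_(i < N) c i ->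
  forall i, gproj i x = if (i < N)%N then c i else 0.
Proof.
move=> cP xE i; pose M := maxn N (size (gdec x)).
pose d j : A := gproj j x - (if (j < N)%N then c j else 0).
pose s := mkseq d (maxn M i.+1).
have leM : (size (gdec x) <= maxn M i.+1)%N by rewrite !leq_max leqnn orbT.
have leN : (N <= maxn M i.+1)%N by rewrite !leq_max leqnn.
have dP j : component j (d j).
  rewrite /d addrC -scaleN1r; apply: componentP (gprojP _ _).
  by case: ifP => [/cP //|_]; apply: component0.
have sP j : component j s`_j.
  have [lt|ge] := ltnP j (maxn M i.+1); first by rewrite nth_mkseq.
  by rewrite nth_default ?size_mkseq //; apply: component0.
have s0 : \sum_(j < size s) s`_j = 0.
  rewrite size_mkseq (eq_bigr (fun j : 'I_ _ => d j)); last first.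
    by move=> j _; rewrite nth_mkseq.
  rewrite big_split sumrN -(big_mkcond (fun j : 'I_(_) => j < N)%N) /=.
  rewrite -(big_ord_widen _ c leN) -xE.
  by rewrite (sum_nth_widen (h := fun _ => id)) // -sum_gproj subrr.
have /eqP := component_direct sP s0 i.
by rewrite nth_mkseq ?leq_max ?leqnn ?orbT // subr_eq0 => /eqP.
Qed.

Lemma gproj_homog n x i : component n x -> gproj i x = if i == n then x else 0.
Proof.
move=> xP; rewrite (@gproj_unique x n.+1 (fun j => if j == n then x else 0)).
- by case: ltnP => // lt; case: eqP lt => // ->; rewrite ltnn.
- by move=> j _; case: eqP => [->|_] //; apply: component0.
- by rewrite big_ord_recr /= eqxx big1 ?add0r // => j _; rewrite ltn_eqF.
Qed.

Lemma gproj_linear n : linear (gproj n).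
Proof.
move=> a x y; pose N := maxn (size (gdec x)) (size (gdec y)).
have Ex : x = \sum_(i < N) gproj i x.
  by rewrite (sum_nth_widen (h := fun _ => id)) ?leq_maxl // -sum_gproj.
have Ey : y = \sum_(i < N) gproj i y.
  by rewrite (sum_nth_widen (h := fun _ => id)) ?leq_maxr // -sum_gproj.
rewrite (@gproj_unique _ N (fun i => a *: gproj i x + gproj i y)); first last.
- by rewrite {1}Ex {1}Ey scaler_sumr -big_split.
- by move=> i _; apply: componentP; apply: gprojP.
- case: ltnP => //; rewrite geq_max => /andP[lx ly].
  by rewrite /gproj !nth_default // scaler0 addr0.
Qed.

(* Two additive maps that agree on homogeneous elements are equal. *)
Lemma homog_ext (V : zmodType) (f g : {additive A -> V}) :
  (forall n x, component n x -> f x = g x) -> f =1 g.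
Proof.
move=> fg x; rewrite (sum_gproj x) !raddf_sum.
by apply: eq_bigr => i _; apply: fg (gprojP _ _).
Qed.

End GradedTheory.

Record twistingSystem (F : fieldType) (A : gradedAlgebra F) := TwistingSystem {
  tau :> nat -> {linear A -> A};
  tau_bij : forall n, bijective (tau n);
  tau_graded : forall n m x, component m x -> component m (tau n x);
  tau_twist : forall n m (x y : A), component m x -> homogeneous y ->
    tau n (x * tau m y) = tau n x * tau (n + m) y
}.

(* The underlying space of the twist of A by t. *)
Definition twist_sort (F : fieldType) (A : gradedAlgebra F)
  (t : twistingSystem A) : Type := A.

Section Twist.
Variables (F : fieldType) (A : gradedAlgebra F) (t : twistingSystem A).
Implicit Types x y z : A.

(* The bilinear extension of x * y = x tau_n(y), x in A_n; see [tmulE]. *)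
Definition tmul x y : A := \sum_(i < size (gdec x)) gproj i x * t i y.

Lemma tmul_widen x y N : (size (gdec x) <= N)%N ->
  tmul x y = \sum_(i < N) gproj i x * t i y.
Proof.
move=> le; rewrite /tmul.
by rewrite -(sum_nth_widen (h := fun i u => u * t i y) _ le) // => i; rewrite mul0r.
Qed.

Lemma tmulE n x y : component n x -> tmul x y = x * t n y.
Proof.
move=> xP; rewrite (@tmul_widen _ _ (maxn (size (gdec x)) n.+1)) ?leq_maxl //.
have lt : (n < maxn (size (gdec x)) n.+1)%N by rewrite leq_max leqnn orbT.
rewrite (bigD1 (Ordinal lt)) //= (gproj_homog _ xP) eqxx.
rewrite big1 ?addr0 // => i ne; rewrite (gproj_homog _ xP).
by rewrite -[n]/(val (Ordinal lt)) (inj_eq val_inj) (negPf ne) mul0r.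
Qed.

Lemma tmul_linearl y : linear (tmul^~ y).
Proof.
move=> a x x'; pose N := maxn (size (gdec (a *: x + x')))
  (maxn (size (gdec x)) (size (gdec x'))).
rewrite !(@tmul_widen _ _ N) ?leq_max ?leqnn ?orbT //.
rewrite scaler_sumr -big_split; apply: eq_bigr => i _ /=.
by rewrite gproj_linear mulrDl scalerAl.
Qed.

Lemma tmul_linearr x : linear (tmul x).
Proof.
move=> a y z; rewrite /tmul scaler_sumr -big_split.
by apply: eq_bigr => i _ /=; rewrite linearP mulrDr scalerAr.
Qed.

Let tl y : {linear A -> A} :=
  HB.pack (tmul^~ y) (GRing.isLinear.Build F A A _ _ (tmul_linearl y)).
Let tr x : {linear A -> A} :=
  HB.pack (tmul x) (GRing.isLinear.Build F A A _ _ (tmul_linearr x)).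

Lemma tmulA : associative tmul.
Proof.
move=> x y z.
rewrite -[LHS]/((tl (tr y z)) x) -[RHS]/((tl z \o tl y) x); move: x.
apply: homog_ext => n x xP /=.
rewrite -[LHS]/((tr x \o tl z) y) -[RHS]/((tl z \o tr x) y); move: y.
apply: homog_ext => m y yP /=.
rewrite -[LHS]/((tr x \o tr y) z) -[RHS]/(tr (tmul x y) z); move: z.
apply: homog_ext => l z zP /=.
rewrite (tmulE _ xP) (tmulE _ yP) (tmulE _ xP).
rewrite (@tmulE (n + m)); last exact: componentM (tau_graded _ _ yP).
by rewrite tau_twist -?mulrA //; exists l.
Qed.

Lemma tau_surj n m x : component m x -> exists2 y, component m y & t n y = x.
Proof.
move=> xP; have [g gK Kg] := tau_bij t n.
exists (gproj m (g x)); first exact: gprojP.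
have e : x = \sum_(i < size (gdec (g x))) t n (gproj i (g x)).
  by rewrite -linear_sum -sum_gproj Kg.
have := gproj_unique (c := fun i => t n (gproj i (g x)))
  (fun i _ => tau_graded t n (gprojP i (g x))) e m.
rewrite (gproj_homog _ xP) eqxx => {2}->; case: ltnP => // le.
by rewrite /gproj nth_default // linear0.
Qed.

(* The identity element of the twist. *)
Definition tone : A := s2val (cid2 (tau_surj 0 (component1 A))).

Lemma tone_comp : component 0 tone.
Proof. by rewrite /tone; case: cid2. Qed.

Lemma tau0_tone : t 0 tone = 1.
Proof. by rewrite /tone; case: cid2. Qed.

Lemma tone_mul : left_id tone tmul.
Proof.
move=> y; rewrite -[LHS]/(tr tone y) -[RHS]/(idfun y); move: y.
apply: homog_ext => m y yP /=; rewrite (tmulE _ tone_comp).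
apply: (bij_inj (tau_bij t 0)); rewrite tau_twist ?tau0_tone ?mul1r //.
- exact: tone_comp.
- by exists m.
Qed.

Lemma tau_tone n : t n tone = 1.
Proof.
have [y yP ty] := tau_surj n (component1 A).
have := tau_twist t n tone_comp (ex_intro _ 0%N yP).
by rewrite -(tmulE _ tone_comp) tone_mul addn0 ty mulr1 => ->.
Qed.

Lemma mul_tone : right_id tone tmul.
Proof.
move=> x; rewrite -[LHS]/(tl tone x) -[RHS]/(idfun x); move: x.
by apply: homog_ext => m x xP /=; rewrite (tmulE _ xP) tau_tone mulr1.
Qed.

Lemma tmulDl : left_distributive tmul +%R.
Proof. by move=> x y z; apply: (linearD (tl z)). Qed.

Lemma tmulDr : right_distributive tmul +%R.
Proof. by move=> x y z; apply: (linearD (tr x)). Qed.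

Lemma tone_neq0 : tone != 0.
Proof.
apply/eqP=> e; have := tau0_tone; rewrite e linear0 => /esym/eqP.
by rewrite oner_eq0.
Qed.

HB.instance Definition _ := GRing.Lmodule.on (twist_sort t).
HB.instance Definition _ := GRing.Zmodule_isNzRing.Build (twist_sort t)
  tmulA tone_mul mul_tone tmulDl tmulDr tone_neq0.
HB.instance Definition _ := GRing.Lmodule_isLalgebra.Build F (twist_sort t)
  (fun a x y => esym (linearZ_LR (tl y) a x)).
HB.instance Definition _ := GRing.Lalgebra_isAlgebra.Build F (twist_sort t)
  (fun a x y => esym (linearZ_LR (tr x) a y)).

Lemma twist_componentM n m (x y : twist_sort t) :
  @component _ A n x -> @component _ A m y -> @component _ A (n + m) (x * y).
Proof.
move=> xP yP; change (x * y) with (tmul x y).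
by rewrite (tmulE _ xP); apply: componentM (tau_graded _ _ yP).
Qed.

Definition twist : gradedAlgebra F :=
  @GradedAlgebra F (twist_sort t) (@component F A) (@component0 F A)
    (@componentP F A) tone_comp twist_componentM (@component_dec F A)
    (@component_direct F A).

End Twist.

Section Monomial.
Variables (F : fieldType).

Definition freeAlgebra (m : nat) := {malg F[{fmonom 'I_m}]}.

Definition free_component (m n : nat) (f : freeAlgebra m) : Prop :=
  forall w : {fmonom 'I_m}, w \in msupp f -> fdeg w = n.

(* The two-sided ideal of R generated by S. *)
Inductive ideal_gen (R : nzRingType) (S : R -> Prop) : R -> Prop :=
| ideal_gen_in x : S x -> ideal_gen S x
| ideal_gen0 : ideal_gen S 0
| ideal_genD x y : ideal_gen S x -> ideal_gen S y -> ideal_gen S (x + y)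
| ideal_genMl r x : ideal_gen S x -> ideal_gen S (r * x)
| ideal_genMr x r : ideal_gen S x -> ideal_gen S (x * r).

(* A is the quotient, via the projection p, of a finitely generated free
   algebra by the ideal generated by the (possibly infinite) set W of words,
   with the induced grading. *)
Definition monomial_algebra (A : gradedAlgebra F) : Prop :=
  exists (m : nat) (W : {fmonom 'I_m} -> Prop)
         (p : {lrmorphism freeAlgebra m -> A}),
  [/\ forall x, exists f, p f = x,
      forall f, p f = 0 <->
        ideal_gen (fun g : freeAlgebra m => exists2 w, W w & g = << w >>) f
    & forall n x, component n x <->
        exists2 f : freeAlgebra m, free_component n f & p f = x].

Definition prime_ring (R : nzRingType) : Prop :=
  forall a b : R, (forall r, a * r * b = 0) -> a = 0 \/ b = 0.

Definition has_dim (V : lmodType F) (U : V -> Prop) (d : nat) : Prop :=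
  exists e : 'I_d -> V,
    (forall i, U (e i)) /\
    (forall v, U v -> exists! c : {ffun 'I_d -> F}, v = \sum_i c i *: e i).

(* h lists the coefficients of the Hilbert series of A. *)
Definition hilbert_series (A : gradedAlgebra F) (h : nat -> nat) : Prop :=
  forall n, has_dim (@component F A n) (h n).

(* Formal power series over int are coefficient sequences with the Cauchy
   product. *)
Definition fps_mul (f g : nat -> int) (n : nat) : int :=
  \sum_(i < n.+1) f i * g (n - i)%N.
Definition fps_of_poly (q : {poly int}) (n : nat) : int := q`_n.

(* The Hilbert series of A is 1 / (1 - t)^2. *)
Definition hilbert_series_P1 (A : gradedAlgebra F) : Prop :=
  exists2 h : nat -> nat, hilbert_series A h &
    fps_mul (fun n => (h n)%:Z) (fps_of_poly ((1 - 'X) ^+ 2))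
      =1 fps_of_poly 1.

Definition monomial_P1 (A : gradedAlgebra F) : Prop :=
  [/\ monomial_algebra A, prime_ring A & hilbert_series_P1 A].

End Monomial.

(* Main.v *)
(* Words of A or B are monomials in the two generators that survive in degree 1.
   By primeness xy and yx are nonzero, so the dimension 3 of A_2 leaves exactly
   one relation in degree 2, the square of a letter y; likewise the relation of B
   is v^2 = 0.  Let f : B -> A^tau be an isomorphism and s_i = tau_i f, so that
   s_i(ab) = s_i(a) s_(i+n)(b) for a in B_n.  Applying s_i to v^2 = 0 gives
   s_i(v) s_(i+1)(v) = 0, hence every s_i(v) is a multiple of y, while s_i(u) is
   a combination of x and y with a nonzero coefficient on x.  Thus f sends a word
   of B to a nonzero multiple of the same word of A (u -> x, v -> y) plus words
   with fewer letters x.  Since nonzero words of A are independent, a word that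
   vanishes in B vanishes in A, and the converse follows by inverting the s_i. *)
From HB Require Import structures.
Require Import Defs.
From mathcomp Require Import all_boot all_order all_algebra.
From mathcomp Require Import finmap boolp zify monalg.

Set Implicit Arguments.
Unset Strict Implicit.
Unset Printing Implicit Defensive.

Import GRing.Theory.
Local Open Scope ring_scope.

(** Letters range over any choice type, so that they can later be renamed to [bool]. *)
Notation freeOn F I := {malg F[{fmonom I}]}.

(** * Uniqueness of dimension *)

Section Dimension.
Variables (F : fieldType) (V : lmodType F).
Implicit Type U : V -> Prop.


(** The two change-of-basis matrices multiply to the identity, because coordinates in the first
    basis are unique; this bounds one size by the other. *)
Lemma has_dim_unique U d1 d2 : has_dim U d1 -> has_dim U d2 -> d1 = d2.
Proof.
suff le U' m n : has_dim U' m -> has_dim U' n -> (m <= n)%N.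
  by move=> h1 h2; apply/eqP; rewrite eqn_leq !(le U).
move=> [e [eU spane]] [e' [eU' spane']].
have /fin_all_exists[c cE] i : exists c : {ffun 'I_n -> F},
    e i = \sum_j c j *: e' j.
  by have [c []] := spane' _ (eU i); exists c.
have /fin_all_exists[d dE] j : exists d : {ffun 'I_m -> F},
    e' j = \sum_i d i *: e i.
  by have [d []] := spane _ (eU' j); exists d.
apply: (@mulmx1_min _ _ _ (\matrix_(i, j) c i j) (\matrix_(j, i) d j i)).
apply/matrixP => i k; rewrite !mxE.
have [b [_ uniq_b]] := spane _ (eU i).
have delta : e i = \sum_k [ffun k => (i == k)%:R] k *: e k.
  rewrite (bigD1 i) //= ffunE eqxx scale1r big1 ?addr0 // => j /negPf ne.
  by rewrite ffunE eq_sym ne scale0r.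
have prodE : e i = \sum_k [ffun k => \sum_j c i j * d j k] k *: e k.
  rewrite cE; under eq_bigr => j _ do rewrite dE scaler_sumr.
  rewrite exchange_big; apply: eq_bigr => l _ /=.
  by rewrite ffunE scaler_suml; apply: eq_bigr => j _; rewrite scalerA.
have /ffunP/(_ k) := etrans (esym (uniq_b _ prodE)) (uniq_b _ delta).
by rewrite !ffunE => <-; apply: eq_bigr => j _; rewrite !mxE.
Qed.

End Dimension.

(** * Free algebras on words and their monomial quotients *)

Section FreeOn.
Variables (F : fieldType) (I : choiceType).
Implicit Types (f g : freeOn F I) (w : {fmonom I}).

Definition homog (n : nat) f := forall w, w \in msupp f -> fdeg w = n.

Lemma monalg_scale (c : F) w : << c *g w >> = c *: << w >> :> freeOn F I.
Proof. by apply/malgP=> u; rewrite mcoeffZ !mcoeffU mulr_natr. Qed.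

Lemma monalgUM w1 w2 :
  (<< w1 >> : freeOn F I) * << w2 >> = << mmul w1 w2 >>.
Proof. by rewrite malgM_def fgmulUU mulr1. Qed.

Lemma in_msuppD f g w :
  w \in msupp (f + g) -> w \in msupp f \/ w \in msupp g.
Proof. by move/(fsubsetP (msuppD_le _ _)); rewrite in_fsetU => /orP. Qed.

Lemma in_msuppZ (c : F) f w : w \in msupp (c *: f) -> w \in msupp f.
Proof. exact: (fsubsetP (msuppZ_le _ _)). Qed.

Lemma homogD n f g : homog n f -> homog n g -> homog n (f + g).
Proof. by move=> hf hg w /in_msuppD[/hf|/hg]. Qed.

Lemma homogZ n (c : F) f : homog n f -> homog n (c *: f).
Proof. by move=> hf w /in_msuppZ/hf. Qed.

Lemma homog0 n : homog n 0.
Proof. by move=> w; rewrite msupp0. Qed.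

Lemma homog_word w : homog (fdeg w) << w >>.
Proof. by move=> u; rewrite msuppU1 in_fset1 => /eqP->. Qed.

Lemma homogM n m f g : homog n f -> homog m g -> homog (n + m) (f * g).
Proof.
by move=> hf hg w /msuppM_le[u [v [/hf <- /hg <- ->]]]; rewrite fdegM.
Qed.

Section IndexedWords.
Variables (K : finType) (phi : K -> {fmonom I}).
Hypothesis phi_inj : injective phi.

Lemma mcoeff_words (c : K -> F) k :
  (\sum_l c l *: << phi l >> : freeOn F I)@_(phi k) = c k.
Proof.
rewrite raddf_sum (bigD1 k) //= big1 => [|l ne].
  by rewrite addr0 mcoeffZ mcoeffUU mulr1.
by rewrite mcoeffZ mcoeffU (inj_eq phi_inj) (negPf ne) mulr0.
Qed.

Lemma homog_words n f :
  (forall k, fdeg (phi k) = n) ->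
  (forall w, fdeg w = n -> exists k, w = phi k) ->
  homog n f -> f = \sum_k f@_(phi k) *: << phi k >>.
Proof.
move=> phi_deg phi_onto hf; apply/malgP => w.
have [/phi_onto[k ->]|ne] := eqVneq (fdeg w) n; first by rewrite mcoeff_words.
rewrite raddf_sum big1 ?mcoeff_outdom // => [|k _].
  by apply: contraNN ne => /hf ->.
rewrite /= mcoeffZ mcoeffU; case: eqP => [kw|_]; last by rewrite mulr0.
by rewrite -kw phi_deg eqxx in ne.
Qed.

End IndexedWords.

(* A graded surjection whose kernel is spanned by words. *)
Definition monomial_presentation (A : gradedAlgebra F)
    (q : {lrmorphism freeOn F I -> A}) :=
  (forall f, q f = 0 -> forall w, w \in msupp f -> q << w >> = 0) /\
  (forall n x, component n x <-> exists2 f, homog n f & q f = x).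

Section Presentation.
Variables (A : gradedAlgebra F) (q : {lrmorphism freeOn F I -> A}).

Lemma lrmorph_words f : q f = \sum_(w <- msupp f) f@_w *: q << w >>.
Proof.
rewrite {1}[f]monalgE raddf_sum; apply: eq_bigr => w _ /=.
by rewrite monalg_scale linearZ.
Qed.

Hypothesis qP : monomial_presentation q.

Lemma presentation_ker f :
  q f = 0 <-> forall w, w \in msupp f -> q << w >> = 0.
Proof.
split=> [|f0]; first exact: qP.1.
by rewrite lrmorph_words big_seq big1 // => w /f0 ->; rewrite scaler0.
Qed.

Lemma presentation_comp n x :
  component n x -> exists2 f, homog n f & q f = x.
Proof. by move/qP.2. Qed.

Lemma presentation_homog n f : homog n f -> component n (q f).
Proof. by move=> hf; apply/qP.2; exists f. Qed.

Lemma presentation_surj x : exists f, q f = x.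
Proof.
have /fin_all_exists[g gE] (i : 'I_(size (gdec x))) :
    exists g, q g = gproj i x.
  by have [g _ <-] := presentation_comp (gprojP i x); exists g.
exists (\sum_i g i); rewrite raddf_sum [RHS]sum_gproj.
by apply: eq_bigr => i _; apply: gE.
Qed.

(** The combination lifts to an element of the kernel in which [phi k] has coefficient [c k]. If
    [c k] were nonzero, the word [phi k] would itself lie in the kernel. *)
Lemma words_independent (K : finType) (phi : K -> {fmonom I}) (c : K -> F) :
  injective phi -> \sum_k c k *: q << phi k >> = 0 ->
  forall k, q << phi k >> != 0 -> c k = 0.
Proof.
move=> phi_inj c0 k; apply: contraNeq => ck.
have /presentation_ker qc : q (\sum_k c k *: << phi k >>) = 0.
  by rewrite raddf_sum -[RHS]c0; apply: eq_bigr => l _; rewrite /= linearZ.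
by apply/eqP/qc; rewrite -mcoeff_neq0 mcoeff_words.
Qed.

(** The nonzero words of degree [n] form a basis of the component. *)
Lemma presentation_dim n (K : finType) (phi : K -> {fmonom I}) :
  injective phi -> (forall k, fdeg (phi k) = n) ->
  (forall w, fdeg w = n -> exists k, w = phi k) ->
  has_dim (@component F A n) #|[set k | q << phi k >> != 0]|.
Proof.
move=> phi_inj phi_deg phi_onto; set S := [set k | _].
exists (fun i => q << phi (enum_val i) >>); split=> [i|v /presentation_comp].
  by apply: presentation_homog => w /homog_word ->.
case=> f hf <-.
have qfE : q f =
    \sum_(i < #|S|) f@_(phi (enum_val i)) *: q << phi (enum_val i) >>.
  rewrite -(big_enum_val (fun k => f@_(phi k) *: q << phi k >>)) /=.
  rewrite {1}(homog_words phi_inj phi_deg phi_onto hf) raddf_sum.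
  rewrite [RHS]big_mkcond; apply: eq_bigr => k _ /=.
  by rewrite linearZ inE /=; case: eqP => /= [->|_]; rewrite ?scaler0.
exists [ffun i => f@_(phi (enum_val i))]; split=> [|c cE].
  by rewrite {1}qfE; apply: eq_bigr => i _; rewrite ffunE.
have phi_val_inj : injective (fun i : 'I_#|S| => phi (enum_val i)).
  by move=> i j /phi_inj/enum_val_inj.
apply/ffunP => i; rewrite ffunE; apply/eqP; rewrite -subr_eq0; apply/eqP.
have := words_independent (c := fun i => f@_(phi (enum_val i)) - c i)
  phi_val_inj.
apply; last by have := enum_valP i; rewrite inE.
under eq_bigr => j _ do rewrite scalerBl.
by rewrite sumrB -cE -qfE subrr.
Qed.

End Presentation.
End FreeOn.

(** The elements all of whose words are killed by [q] form a two-sided ideal containing the defining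
    monomials, hence containing the kernel. *)
Lemma monomial_algebra_presentation (F : fieldType) (A : gradedAlgebra F) :
  monomial_algebra A -> exists m (q : {lrmorphism freeOn F 'I_m -> A}),
    monomial_presentation q.
Proof.
case=> m [W [q [_ q_ker q_comp]]]; exists m, q; split=> // f /q_ker.
have word0 w : W w -> q << w >> = 0.
  by move=> Ww; apply/q_ker; apply: ideal_gen_in; exists w.
elim=> {f} [g [w Ww ->] u||f g _ hf _ hg w|f g _ hg w|f g _ hf w].
- by rewrite msuppU1 in_fset1 => /eqP->; apply: word0.
- by move=> w; rewrite msupp0.
- by case/in_msuppD; [apply: hf|apply: hg].
- case/msuppM_le => u [v [_ /hg v0 ->]].
  by rewrite -monalgUM rmorphM /= v0 mulr0.
- case/msuppM_le => u [v [/hf u0 _ ->]].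
  by rewrite -monalgUM rmorphM /= u0 mul0r.
Qed.

(** * Universal property of the free algebra *)

Section Evaluation.
Variables (F : fieldType) (I : choiceType) (A : algType F) (X : I -> A).

Definition word_eval (w : {fmonom I}) : A := \prod_(i <- w) X i.

Lemma word_eval_mmorphism : mmorphism word_eval.
Proof.
by split=> [u v|]; rewrite /word_eval ?fmM ?big_cat // fm1 big_nil.
Qed.

HB.instance Definition _ :=
  isMultiplicative.Build {fmonom I} A word_eval word_eval_mmorphism.

Definition free_eval : freeOn F I -> A := mmap (in_alg A) word_eval.

(** Multiplicativity holds because the scalars are central in [A]. *)
Lemma free_eval_monoid_morphism : monoid_morphism free_eval.
Proof.
have [fM f1] : multiplicative free_eval.
  by apply: commr_mmap_is_multiplicative => f u v /=; apply: comm_alg.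
by [].
Qed.

HB.instance Definition _ := GRing.Additive.on free_eval.
HB.instance Definition _ :=
  GRing.isMonoidMorphism.Build _ _ free_eval free_eval_monoid_morphism.

Lemma free_eval_scalable : scalable free_eval.
Proof. by move=> c f; rewrite /free_eval mmapZ /= mulr_algl. Qed.

HB.instance Definition _ :=
  GRing.isScalable.Build F _ A _ free_eval free_eval_scalable.

Lemma free_eval_word w : free_eval << w >> = \prod_(i <- w) X i.
Proof. by rewrite /free_eval mmapU /= scale1r mul1r. Qed.

End Evaluation.

(** * Induction on words and words of length one and two *)

Section Words.
Variables (I : choiceType).

Lemma fmonom_ind (P : {fmonom I} -> Prop) :
  P mone -> (forall i w, P w -> P (mmul (fmu i) w)) -> forall w, P w.
Proof.
move=> P1 PM [s]; elim: s => [|i s IHs].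
  by rewrite (_ : FMonom _ = mone) //; apply: val_inj; rewrite /= fm1.
rewrite (_ : FMonom _ = mmul (fmu i) (FMonom s)); first exact: PM.
by apply: val_inj; rewrite /= fmM fmU.
Qed.

Lemma fmonom1P (w : {fmonom I}) : fdeg w = 1%N -> exists i, w = fmu i.
Proof.
case: w => [[|i [|//]]] // _; exists i.
by apply: val_inj; rewrite /= fmU.
Qed.

Lemma fmonom2P (w : {fmonom I}) :
  fdeg w = 2%N -> exists k : I * I, w = mmul (fmu k.1) (fmu k.2).
Proof.
case: w => [[|i [|j [|//]]]] // _; exists (i, j).
by apply: val_inj; rewrite /= fmM !fmU.
Qed.

Lemma fmu_inj : injective (@fmu I).
Proof. by move=> i j /(congr1 val); rewrite /= !fmU => -[]. Qed.

Lemma fmu2_inj : injective (fun k : I * I => mmul (fmu k.1) (fmu k.2)).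
Proof.
by move=> [i j] [k l] /(congr1 val); rewrite /= !fmM !fmU => -[-> ->].
Qed.

End Words.

(** * Dropping vanishing letters and renaming the others *)

Section Restriction.
Variables (F : fieldType) (A : gradedAlgebra F).

Lemma component_sum n (T : eqType) (r : seq T) (x : T -> A) :
  (forall i, i \in r -> component n (x i)) ->
  component n (\sum_(i <- r) x i).
Proof.
move=> xP; rewrite big_seq; elim/big_rec: _ => [|i y /xP ix].
  exact: component0.
exact: componentD.
Qed.

Variables (I J : choiceType) (e : J -> I).
Variables (q : {lrmorphism freeOn F I -> A}).
Hypotheses (qP : monomial_presentation q) (e_inj : injective e).
Hypothesis e_onto : forall i, q << fmu i >> = 0 \/ exists j, i = e j.

Let r : {lrmorphism freeOn F J -> A} :=
  free_eval (fun j => q << fmu (e j) >>).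
Let phi (w : {fmonom J}) : {fmonom I} := FMonom (map e w).

(** A letter outside the image of [e] is zero in [A], so removing it loses no element of the
    quotient, and the kernel remains spanned by words. This serves both to discard zero letters and
    to exchange two letters. *)
Lemma presentation_letters :
  exists2 r : {lrmorphism freeOn F J -> A}, monomial_presentation r &
    forall j, r << fmu j >> = q << fmu (e j) >>.
Proof.
exists r; last by move=> j; rewrite /= free_eval_word fmU big_seq1.
have phi_inj : injective phi.
  by move=> u v /(congr1 val)/(inj_map e_inj)/val_inj.
have r_word w : r << w >> = q << phi w >>.
  elim/fmonom_ind: w => [|j w IHw].
    rewrite (_ : phi _ = mone) ?rmorph1 //.
    by apply: val_inj; rewrite /= !fm1.
  rewrite -monalgUM rmorphM /= IHw free_eval_word fmU big_seq1 -rmorphM.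
  rewrite monalgUM; congr (q << _ >>).
  by apply: val_inj; rewrite /= !fmM !fmU.
split=> [f rf0 w wf|n x].
  (* [g] is [f] with its letters renamed by [e]; injectivity of the renaming keeps the coefficients
     from merging. *)
  pose g : freeOn F I := \sum_(u <- msupp f) f@_u *: << phi u >>.
  have qg0 : q g = 0.
    rewrite -[RHS]rf0 [RHS]lrmorph_words /g raddf_sum; apply: eq_bigr => u _.
    by rewrite r_word /= linearZ.
  rewrite r_word; apply: (qP.1 _ qg0); rewrite -mcoeff_neq0 /g raddf_sum /=.
  rewrite (big_fsetD1 w) //= big1_fset ?addr0 => [|u].
    by rewrite mcoeffZ mcoeffUU mulr1 mcoeff_neq0.
  rewrite in_fsetD1 => /andP[ne _] _.
  by rewrite mcoeffZ mcoeffU (inj_eq phi_inj) (negPf ne) mulr0.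
split=> [/(presentation_comp qP)[f hf <-]|[f hf <-]]; last first.
  rewrite lrmorph_words; apply: component_sum => w /hf <-.
  apply: componentZ; rewrite r_word; apply: (presentation_homog qP) => u.
  by rewrite msuppU1 in_fset1 => /eqP->; rewrite /fdeg size_map.
(* A word with a vanishing letter lifts to 0, which is homogeneous of every degree. *)
have lift (w : {fmonom I}) : exists2 g, homog (fdeg w) g & r g = q << w >>.
  elim/fmonom_ind: w => [|i w [g hg gE]].
    exists (<< mone >> : freeOn F J).
      by rewrite fdeg1 -(@fdeg1 J); apply: homog_word.
    exact: etrans (rmorph1 r) (esym (rmorph1 q)).
  rewrite fdegM fdegU; case: (e_onto i) => [i0|[j ->]].
    exists 0; first exact: homog0.
    by rewrite -monalgUM rmorphM /= i0 mul0r raddf0.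
  exists (<< fmu j >> * g).
    by rewrite -(fdegU j); apply: homogM => //; apply: homog_word.
  rewrite -monalgUM !rmorphM /= gE free_eval_word fmU big_seq1.
  by [].
have [g gP gE] : exists2 g : {fmonom I} -> freeOn F J,
    forall w, homog (fdeg w) (g w) & forall w, r (g w) = q << w >>.
  have /choice[g gP] : forall w, exists g, homog (fdeg w) g /\ r g = q << w >>.
    by move=> w; have [g] := lift w; exists g.
  by exists g => w; case: (gP w).
exists (\sum_(w <- msupp f) f@_w *: g w).
  rewrite big_seq; elim/big_rec: _ => [|w h wf hh]; first exact: homog0.
  by apply: homogD => //; apply: homogZ; rewrite -(hf w wf); apply: gP.
rewrite raddf_sum lrmorph_words; apply: eq_bigr => w _.
by rewrite -gE /= linearZ.
Qed.

End Restriction.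

(** * Normal form: two letters, one of square zero *)

Section TwoLetters.
Variables (F : fieldType) (A : gradedAlgebra F).

Definition letter (I : choiceType) (q : {lrmorphism freeOn F I -> A}) i : A :=
  q << fmu i >>.

Lemma letterM (I : choiceType) (q : {lrmorphism freeOn F I -> A}) i j :
  letter q i * letter q j = q << mmul (fmu i) (fmu j) >>.
Proof. by rewrite -rmorphM /= monalgUM. Qed.

Lemma lrmorph_letters (I : finType) (q : {lrmorphism freeOn F I -> A}) c :
  q (\sum_i c i *: << fmu i >>) = \sum_i c i *: letter q i.
Proof. by rewrite raddf_sum; apply: eq_bigr => i _; rewrite /= linearZ. Qed.

(* [false] names the letter of square zero. *)
Definition normal_presentation (q : {lrmorphism freeOn F bool -> A}) :=
  monomial_presentation q /\
  forall b c, (letter q b * letter q c == 0) = ~~ (b || c).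

(** The nonzero letters form a basis of degree 1, so there are exactly two of them. *)
Lemma dim1_presentation :
  monomial_algebra A -> has_dim (@component F A 1) 2 ->
  exists2 q : {lrmorphism freeOn F bool -> A}, monomial_presentation q &
    forall b, letter q b != 0.
Proof.
case/monomial_algebra_presentation=> m [p pP] dim1.
have := presentation_dim pP (@fmu_inj _) (@fdegU _) (@fmonom1P _).
move/(has_dim_unique dim1)/esym/eqP/cards2P => -[i [j [ne_ij /setP ijP]]].
pose e b := if b then i else j.
have e_inj : injective e.
  by case=> -[] //= /eqP; rewrite ?(negPf ne_ij) // eq_sym (negPf ne_ij).
have [|q qP qE] := presentation_letters pP e_inj.
  move=> k; have := ijP k; rewrite !inE; case: eqP => [|_ /esym/orP].
    by left.
  by case=> /eqP->; right; [exists true|exists false].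
exists q => // b; rewrite /letter qE.
by have := ijP (e b); rewrite !inE => ->; case: b; rewrite eqxx ?orbT.
Qed.

Lemma prime_letterM (q : {lrmorphism freeOn F bool -> A}) b :
  prime_ring A -> monomial_presentation q -> (forall c, letter q c != 0) ->
  letter q b * letter q (~~ b) != 0.
Proof.
move=> primeA qP q0; apply/eqP => xy0.
(* Somewhere between the outer letters [b] and [~~ b], a [b] is directly followed by [~~ b]. The
   induction scans [w] from the left: a first letter [~~ b] gives zero at once, a first letter [b]
   takes over the role of the outer one. *)
have words w : letter q b * q << w >> * letter q (~~ b) = 0.
  elim/fmonom_ind: w => [|c w IHw].
    by rewrite (_ : q _ = 1) ?mulr1 //; apply: (rmorph1 q).
  rewrite -monalgUM rmorphM /= mulrA -/(letter q c).
  have [->|ne] := eqVneq c b; last first.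
    have -> : c = ~~ b by case: (b) (c) ne => -[].
    by rewrite xy0 !mul0r.
  by rewrite -mulrA -mulrA [X in _ * X]mulrA IHw mulr0.
have [r||] := primeA (letter q b) (letter q (~~ b)); last 2 first.
- exact/eqP.
- exact/eqP.
have [f <-] := presentation_surj qP r.
rewrite lrmorph_words mulr_sumr mulr_suml big1 // => w _.
by rewrite -scalerAr -scalerAl words scaler0.
Qed.

Lemma swap_presentation (q : {lrmorphism freeOn F bool -> A}) :
  monomial_presentation q ->
  exists2 q' : {lrmorphism freeOn F bool -> A}, monomial_presentation q' &
    forall b, letter q' b = letter q (~~ b).
Proof.
move=> qP; apply: (presentation_letters qP (inv_inj negbK)).
by move=> b; right; exists (~~ b); rewrite negbK.
Qed.

Lemma exists_normal_presentation :
  monomial_algebra A -> prime_ring A ->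
  has_dim (@component F A 1) 2 -> has_dim (@component F A 2) 3 ->
  exists q, normal_presentation q.
Proof.
move=> monA primeA dim1 dim2.
have [q qP q0] := dim1_presentation monA dim1.
have := presentation_dim qP (@fmu2_inj _) _ (@fmonom2P _).
have deg2 (k : bool * bool) : fdeg (mmul (fmu k.1) (fmu k.2)) = 2%N.
  by rewrite fdegM !fdegU.
move/(_ deg2)/(has_dim_unique dim2)/esym.
have xy b := prime_letterM b primeA qP q0.
rewrite cardsE -sum1_card big_mkcond /=.
under eq_bigr => k _ do rewrite unfold_in /= -letterM.
rewrite -(pair_bigA _ (fun b c =>
  if letter q b * letter q c != 0 then 1%N else 0%N)).
rewrite !big_bool /= (xy true) (xy false).
case: eqP => tt; case: eqP => ff // _.
  (* Three of the four products are nonzero and both mixed ones are, so exactly one square vanishes.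
     Here it is that of [true], and the letters are exchanged. *)
  have [q' q'P q'E] := swap_presentation qP.
  exists q'; split=> // b c; rewrite !q'E.
  case: b c => -[] /=; rewrite ?tt ?eqxx //; apply/negbTE.
  - exact/eqP.
  - exact: xy false.
  - exact: xy true.
exists q; split=> // b c.
case: b c => -[] /=; rewrite ?ff ?eqxx //; apply/negbTE.
- exact/eqP.
- exact: xy true.
- exact: xy false.
Qed.

End TwoLetters.

(** * Isomorphisms from equality of vanishing words *)

Lemma lrmorph_factor (F : fieldType) (R : lalgType F) (A B : algType F)
    (p : {lrmorphism R -> A}) (q : {lrmorphism R -> B}) :
  (forall x, exists f, p f = x) -> (forall f, p f = 0 -> q f = 0) ->
  exists g : {lrmorphism A -> B}, forall f, g (p f) = q f.
Proof.
move=> /choice[lift pK] ker_pq; pose g x := q (lift x).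
have gE f : g (p f) = q f.
  by apply/eqP; rewrite -subr_eq0 -raddfB /= ker_pq // raddfB /= pK subrr.
have g_lin : linear g.
  move=> c x y; rewrite -[x]pK -[y]pK !gE -linearZ -raddfD gE.
  by rewrite raddfD /= linearZ.
have g_mul : monoid_morphism g.
  split=> [|x y]; first by rewrite -(rmorph1 p) gE rmorph1.
  by rewrite -[x]pK -[y]pK !gE -rmorphM gE rmorphM.
pose g' : {lrmorphism A -> B} := HB.pack g
  (GRing.isLinear.Build F A B _ g g_lin)
  (GRing.isMonoidMorphism.Build A B g g_mul).
by exists g'.
Qed.

(** Both kernels are spanned by words, so they coincide; factoring each presentation through the
    other gives mutually inverse maps. *)
Lemma presentation_iso (F : fieldType) (I : choiceType) (A B : gradedAlgebra F)
    (p : {lrmorphism freeOn F I -> A}) (q : {lrmorphism freeOn F I -> B}) :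
  monomial_presentation p -> monomial_presentation q ->
  (forall w, p << w >> = 0 <-> q << w >> = 0) -> graded_iso A B.
Proof.
move=> pP qP pq.
have [f|g gE] := lrmorph_factor (q := q) (presentation_surj pP).
  by move/(presentation_ker pP)=> f0; apply/(presentation_ker qP)=> w /f0/pq.
have [f|h hE] := lrmorph_factor (q := p) (presentation_surj qP).
  by move/(presentation_ker qP)=> f0; apply/(presentation_ker pP)=> w /f0/pq.
exists g; split=> [|n x /(presentation_comp pP)[f hf <-]]; last first.
  by rewrite gE; apply: presentation_homog.
exists h => x.
- by have [f <-] := presentation_surj pP x; rewrite gE hE.
- by have [f <-] := presentation_surj qP x; rewrite hE gE.
Qed.

(** * From a twisting system to a family of shifted maps *)

Section Shifts.
Variables (F : fieldType) (A B : gradedAlgebra F).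

(* For B isomorphic to a twist of A by tau via f, the maps s i = tau_i \o f
   retain all that is needed of the twisting system. *)
Record shifts (s : nat -> {linear B -> A}) : Prop := Shifts {
  shift_inj i : injective (s i);
  shift_comp i n x : component n (s i x) <-> component n x;
  shift_surj i y : exists x, s i x = y;
  shift1 i : s i 1 = 1;
  shiftM i n x y : component n x -> s i (x * y) = s i x * s (i + n)%N y
}.

(** The twisting identity extends from homogeneous [y] to all [y] by additivity. *)
Lemma tau_twistE (t : twistingSystem A) n m (x y : A) : component m x ->
  t n (x * t m y) = t n x * t (n + m)%N y.
Proof.
move=> xP; rewrite (sum_gproj y) !raddf_sum !mulr_sumr raddf_sum.
apply: eq_bigr => i _; apply: tau_twist => //.
by exists i; apply: gprojP.
Qed.

Lemma graded_inj_reflect (C : gradedAlgebra F) (f : {linear B -> C}) n x :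
  injective f -> (forall m y, component m y -> component m (f y)) ->
  component n (f x) -> component n x.
Proof.
move=> f_inj f_comp fxP.
have fxE : f x = \sum_(i < size (gdec x)) f (gproj i x).
  by rewrite -raddf_sum -sum_gproj.
have := gproj_unique (fun i _ => f_comp _ _ (gprojP i x)) fxE n.
(* By uniqueness of components, [f x] is the image of the [n]-th component of [x]. If [n] lies
   beyond the decomposition, then [f x = 0] and so [x = 0]. *)
rewrite (gproj_homog _ fxP) eqxx; case: ltnP => [_ /f_inj->|_ /eqP].
  exact: gprojP.
by rewrite raddf_eq0 // => /eqP ->; apply: component0.
Qed.

Lemma twist_shifts (t : twistingSystem A) :
  graded_iso B (twist t) -> exists s, shifts s.
Proof.
case=> f [f_bij f_comp].
(* The twist has the same underlying space as [A], so [f] is also a linear map to [A]; only its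
   compatibility with products changes. *)
have f_lin : @GRing.linear_for F B A *:%R f := linearP f.
pose fA : {linear B -> A} := HB.pack (f : B -> A)
  (GRing.isLinear.Build F B A _ (f : B -> A) f_lin).
have tf_inj i : injective (t i \o fA).
  by apply: inj_comp (bij_inj (tau_bij t i)) (bij_inj f_bij).
have tf_comp i n x : component n x -> component n ((t i \o fA) x).
  by move=> xP; apply/tau_graded/(f_comp _ _ xP).
exists (fun i => t i \o fA); split=> [||i y|i|i n x y xP].
- exact: tf_inj.
- move=> i n x; split; last exact: tf_comp.
  exact: (graded_inj_reflect (f := t i \o fA) (tf_inj i) (tf_comp i)).
- have [g _ gK] := f_bij; have [h _ hK] := tau_bij t i.
  by exists (g (h y)); rewrite /= [fA _]gK hK.
(* The unit of the twist may differ from that of [A], but every [t i] sends it to 1. *)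
- by rewrite /= [fA 1](rmorph1 f); apply: tau_tone.
- have fM : fA (x * y) = fA x * t n (fA y).
    rewrite [fA _](rmorphM f).
    exact: (tmulE t (f y) (f_comp _ _ xP)).
  by rewrite /= fM tau_twistE //; apply: f_comp.
Qed.

Variables (s : nat -> {linear B -> A}).
Hypothesis sP : shifts s.

(** [s 0] is a graded linear bijection, so bases of [A] pull back to [B]. *)
Lemma shift_dim n d :
  has_dim (@component F A n) d -> has_dim (@component F B n) d.
Proof.
have /choice[g gK] := shift_surj sP 0.
case=> e [eP span]; exists (fun i => g (e i)); split=> [i|v vP].
  by apply/(shift_comp sP 0); rewrite gK.
have combE (c : {ffun 'I_d -> F}) :
    s 0 (\sum_i c i *: g (e i)) = \sum_i c i *: e i.
  by rewrite raddf_sum; apply: eq_bigr => i _; rewrite /= linearZ /= gK.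
have [c [cE c_uniq]] := span _ ((shift_comp sP 0 n v).2 vP).
exists c; split=> [|c' c'E]; last by apply: c_uniq; rewrite c'E combE.
by apply: (shift_inj sP (i := 0)); rewrite combE.
Qed.

End Shifts.

(** * Leading words with respect to the number of letters [true] *)

Section Triangular.
Variable F : fieldType.
Implicit Types (w : {fmonom bool}) (f g : freeOn F bool).

(** [count id] is the number of letters [true]. The word [w] acts as a leading term: it alone
    attains the maximal count. *)
Definition triangular w f :=
  f@_w != 0 /\ forall u, u \in msupp f -> u != w -> (count id u < count id w)%N.

Lemma triangular_le w f u :
  triangular w f -> u \in msupp f -> (count id u <= count id w)%N.
Proof.
by case=> _ wf uf; have [->|/(wf u uf)/ltnW] := eqVneq u w.
Qed.

(** The count is additive under concatenation, so any pair of words other than the leading pair has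
    a smaller total and cannot cancel the product of the leading coefficients. *)
Lemma triangularM w1 w2 f1 f2 : triangular w1 f1 -> triangular w2 f2 ->
  triangular (mmul w1 w2) (f1 * f2).
Proof.
move=> T1 T2.
have lt u1 u2 : u1 \in msupp f1 -> u2 \in msupp f2 ->
    (u1 != w1) || (u2 != w2) ->
    (count id (mmul u1 u2) < count id (mmul w1 w2))%N.
  move=> uf1 uf2; rewrite !fmM !count_cat => /orP[ne|ne].
    by rewrite -addSn leq_add ?(T1.2) ?(triangular_le T2).
  by rewrite -addnS leq_add ?(T2.2) ?(triangular_le T1).
split=> [|u /msuppM_le[u1 [u2 [uf1 uf2 ->]]] ne]; last first.
  apply: lt => //; rewrite -negb_and; apply: contraNN ne.
  by case/andP=> /eqP-> /eqP->.
have [f1w f2w] := (T1.1, T2.1).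
rewrite mcoeffMl (big_fsetD1 w1) -?mcoeff_neq0 //=.
rewrite (big_fsetD1 w2) -?mcoeff_neq0 //= eqxx mulr1n.
(* Another pair with the same product would have a count smaller than itself. *)
rewrite !big1_fset ?addr0 ?mulf_neq0 // => [u1|u2].
  rewrite in_fsetD1 => /andP[ne uf1] _.
  rewrite big1_fset // => u2 uf2 _; case: eqP => // e.
  by have := lt _ _ uf1 uf2; rewrite ne e ltnn => /(_ isT).
rewrite in_fsetD1 => /andP[ne uf2] _; case: eqP => // e.
have := lt w1 _ _ uf2; rewrite ne orbT e ltnn -mcoeff_neq0.
by move=> /(_ f1w isT).
Qed.

Lemma triangular1 : triangular mone 1.
Proof.
split=> [|u]; first by rewrite mcoeff1 eqxx oner_eq0.
by rewrite msuppU1 in_fset1 => ->.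
Qed.

Lemma triangular_false c : c != 0 ->
  triangular (fmu false) (c *: << fmu false >>).
Proof.
move=> c0; split=> [|u /in_msuppZ]; first by rewrite mcoeffZ mcoeffUU mulr1.
by rewrite msuppU1 in_fset1 => ->.
Qed.

Lemma triangular_true (c : bool -> F) : c true != 0 ->
  triangular (fmu true) (\sum_b c b *: << fmu b >>).
Proof.
move=> c0; split=> [|u]; first by rewrite (mcoeff_words (@fmu_inj _)).
rewrite big_bool => /in_msuppD[] /in_msuppZ; rewrite msuppU1 in_fset1 => /eqP->.
  by rewrite eqxx.
by rewrite !fmU.
Qed.

Lemma triangular_kernel (A : gradedAlgebra F)
    (q : {lrmorphism freeOn F bool -> A}) w f :
  monomial_presentation q -> triangular w f -> q f = 0 -> q << w >> = 0.
Proof.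
by move=> qP [fw _] /(presentation_ker qP); apply; rewrite -mcoeff_neq0.
Qed.

End Triangular.

(** * Degrees one and two of a normal presentation *)

Section Normal.
Variables (F : fieldType) (A : gradedAlgebra F).
Variables (q : {lrmorphism freeOn F bool -> A}).
Hypothesis qN : normal_presentation q.
Let qP : monomial_presentation q := qN.1.
Local Notation x := (letter q true).
Local Notation y := (letter q false).

Lemma letter_comp b : component 1 (letter q b).
Proof.
by rewrite -(fdegU b); apply: (presentation_homog qP); apply: homog_word.
Qed.

Lemma letter_neq0 b : letter q b != 0.
Proof.
have := qN.2 b true; rewrite orbT /= => /negbT.
by apply: contraNneq => ->; rewrite mul0r.
Qed.

Lemma component1_letters z :
  component 1 z -> exists c : bool -> F, z = \sum_b c b *: letter q b.
Proof.
case/(presentation_comp qP)=> f hf <-; exists (fun b => f@_(fmu b)).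
rewrite {1}(homog_words (@fmu_inj _) (@fdegU _) (@fmonom1P _) hf).
exact: lrmorph_letters.
Qed.

(* The only relation of degree 2 is y * y = 0, a decomposable tensor. *)
Lemma degree2_relation (c d : bool -> F) :
  (\sum_b c b *: letter q b) * (\sum_b d b *: letter q b) = 0 ->
  \sum_b d b *: letter q b != 0 -> c true = 0.
Proof.
rewrite big_distrlr pair_bigA /= => cd0; apply: contraNeq => c0.
pose cd (k : bool * bool) := c k.1 * d k.2.
have {}cd0 : \sum_k cd k *: q << mmul (fmu k.1) (fmu k.2) >> = 0.
  rewrite -[RHS]cd0; apply: eq_bigr => k _.
  by rewrite -letterM -scalerAl -scalerAr scalerA.
rewrite big1 // => b _.
(* The word [(true, b)] is nonzero for either [b], so [c true * d b] vanishes. *)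
have := words_independent qP (@fmu2_inj _) cd0 (k := (true, b)).
rewrite -letterM qN.2 => /(_ isT)/eqP.
by rewrite mulf_eq0 (negPf c0) => /eqP->; rewrite scale0r.
Qed.

End Normal.

(** * Comparing the vanishing words of [A] and [B] *)

Section Comparison.
Variables (F : fieldType) (A B : gradedAlgebra F).
Variables (p : {lrmorphism freeOn F bool -> A}).
Variables (q : {lrmorphism freeOn F bool -> B}).
Hypotheses (pN : normal_presentation p) (qN : normal_presentation q).
Variable s : nat -> {linear B -> A}.
Hypothesis sP : shifts s.
Let pP := pN.1.
Let qP := qN.1.

Lemma shift_neq0 i z : z != 0 -> s i z != 0.
Proof. by move=> z0; rewrite raddf_eq0 //; apply: (shift_inj sP (i := i)). Qed.

(* Applying s i to v * v = 0 gives s_i(v) s_(i+1)(v) = 0 in A, which must be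
   a multiple of the relation y * y = 0. *)
Lemma shift_false i :
  exists2 c, c != 0 & s i (letter q false) = c *: letter p false.
Proof.
have v1 := letter_comp qN false; have v0 := letter_neq0 qN false.
have [c cE] := component1_letters pN ((shift_comp sP i _ _).2 v1).
have [d dE] := component1_letters pN ((shift_comp sP i.+1 _ _).2 v1).
have vv : s i (letter q false * letter q false) = 0.
  by have /eqP-> := qN.2 false false; rewrite raddf0.
have c0 : c true = 0.
  move: vv; rewrite (shiftM sP _ _ v1) addn1 cE dE.
  by move/(degree2_relation pN); apply; rewrite -dE shift_neq0.
rewrite big_bool /= c0 scale0r add0r in cE.
exists (c false) => //.
by apply: contraNneq (shift_neq0 i v0) => b0; rewrite cE b0 scale0r.
Qed.

(** With [c true = 0], injectivity of [s i] would make u a multiple of v, and then u would also have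
    square zero. *)
Lemma shift_true i : exists2 c : bool -> F, c true != 0 &
  s i (letter q true) = \sum_b c b *: letter p b.
Proof.
have [c cE] :=
  component1_letters pN ((shift_comp sP i _ _).2 (letter_comp qN true)).
exists c => //; apply/eqP => c0.
have [d d0 dE] := shift_false i.
have uE : letter q true = (c false / d) *: letter q false.
  apply: (shift_inj sP (i := i)).
  by rewrite linearZ /= dE cE big_bool /= c0 scale0r add0r scalerA divfK.
have := qN.2 true true; rewrite /= {1}uE -scalerAl uE -scalerAr.
have /eqP-> := qN.2 false false.
by rewrite !scaler0 eqxx.
Qed.

(** Splitting off a first letter raises the index to [i.+1], so the induction is uniform in [i];
    leading words multiply by [triangularM]. *)
Lemma shift_word w i :
  exists2 f, triangular w f & s i (q << w >>) = p f.
Proof.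
elim/fmonom_ind: w i => [|b w IHw] i.
  exists 1; first exact: triangular1.
  by rewrite (_ : q _ = 1) ?(shift1 sP) ?rmorph1 //; apply: (rmorph1 q).
have [f Tf fE] := IHw i.+1.
suff [h Th hE] : exists2 h, triangular (fmu b) h & s i (letter q b) = p h.
  exists (h * f); first exact: triangularM.
  rewrite -monalgUM !rmorphM /= -hE -fE -addn1.
  exact: shiftM sP _ _ _ _ (letter_comp qN b).
case: b.
  have [c c0 cE] := shift_true i.
  exists (\sum_b c b *: << fmu b >>); first exact: triangular_true.
  by rewrite cE lrmorph_letters.
have [c c0 cE] := shift_false i.
exists (c *: << fmu false >>); first exact: triangular_false.
by rewrite cE linearZ.
Qed.

Lemma unshift_word w i :
  exists2 f, triangular w f & p << w >> = s i (q f).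
Proof.
elim/fmonom_ind: w i => [|b w IHw] i.
  exists 1; first exact: triangular1.
  by rewrite (_ : p _ = 1) ?rmorph1 ?(shift1 sP) //; apply: (rmorph1 p).
have [f Tf fE] := IHw i.+1.
suff [h Th hE] : exists2 h, triangular (fmu b) h & letter p b = s i (q h).
  have h1 : component 1 (q h).
    by apply/(shift_comp sP i); rewrite -hE; apply: letter_comp.
  exists (h * f); first exact: triangularM.
  rewrite -monalgUM !rmorphM /= [p << fmu b >>]hE fE.
  by rewrite (shiftM sP _ _ h1) addn1.
have [c c0 cE] := shift_false i.
case: b; last first.
  exists (c^-1 *: << fmu false >>).
    by apply: triangular_false; rewrite invr_eq0.
  by rewrite linearZ /= linearZ /= cE scalerA mulVf ?scale1r.
have [d d0 dE] := shift_true i.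
(* These coefficients invert the triangular system that expresses the images of u and v under [s i]
   in terms of x and y, solved for x. *)
pose e b := if b then (d true)^-1 else - ((d true)^-1 * d false / c).
exists (\sum_b e b *: << fmu b >>).
  by apply: triangular_true; rewrite invr_eq0.
rewrite lrmorph_letters big_bool /= raddfD /= !linearZ /= dE cE big_bool /=.
by rewrite scalerDr !scalerA mulVf // scale1r mulNr divfK // scaleNr addrK.
Qed.

(** An element of the kernel has its leading word in the kernel; injectivity of [s 0] carries the
    vanishing back to [B]. *)
Lemma zero_words w : p << w >> = 0 <-> q << w >> = 0.
Proof.
have [f Tf fE] := shift_word w 0; have [g Tg gE] := unshift_word w 0.
split=> w0.
  apply: triangular_kernel qP Tg _; apply: (shift_inj sP (i := 0)).
  by rewrite -gE w0 raddf0.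
by apply: triangular_kernel pP Tf _; rewrite -fE w0 raddf0.
Qed.

End Comparison.

(** * Low-degree dimensions and the conclusion *)

Lemma hilbert_series_P1_dim (F : fieldType) (A : gradedAlgebra F) :
  hilbert_series_P1 A ->
  has_dim (@component F A 1) 2 /\ has_dim (@component F A 2) 3.
Proof.
case=> h hA hE.
have [h1 h2] : h 1%N = 2%N /\ h 2%N = 3%N.
  (* The coefficients of degrees 0, 1 and 2 successively determine [h 0 = 1], [h 1 = 2] and
     [h 2 = 3]. *)
  have := hE 0%N; have := hE 1%N; have := hE 2%N.
  rewrite /fps_mul /fps_of_poly !big_ord_recr !big_ord0 /=.
  have -> : (1 - 'X) ^+ 2 = 1 - 'X *+ 2 + 'X^2 :> {poly int}.
    by rewrite sqrrB expr1n mul1r.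
  rewrite !coefE /=.
  lia.
by have := hA 2%N; have := hA 1%N; rewrite h1 h2.
Qed.

Theorem proposition10p6 (F : fieldType) (A B : gradedAlgebra F)
  (hA : monomial_P1 A) (hBmon : monomial_algebra B) (hBprime : prime_ring B)
  (hBA : exists t : twistingSystem A, graded_iso B (twist t)) :
  graded_iso A B.
Proof.
have [Amon Aprime /hilbert_series_P1_dim[dim1 dim2]] := hA.
have [t /twist_shifts[s sP]] := hBA.
have [p pN] := exists_normal_presentation Amon Aprime dim1 dim2.
have [q qN] := exists_normal_presentation hBmon hBprime
  (shift_dim sP dim1) (shift_dim sP dim2).
exact: presentation_iso pN.1 qN.1 (zero_words pN qN sP).
Qed.
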